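(* Let $\mu$ and $\nu$ be finite (positive, nonzero) Borel measures on $\mathbb{R}^n$ and $\mathbb{R}^m$ respectively, let $\Gamma$ be an additive subgroup of $\mathbb{R}^n$, and let $\rho=\mu\times\nu$ be the product measure on $\mathbb{R}^{n+m}$. Suppose that $$\mathcal{Z}(\widehat{\mu})\cup\{0\}\subset\Gamma .$$ Then: (1) If $\rho$ is a spectral measure, then $\rho$ admits a spectrum $\Lambda$ such that $\Lambda\subset\Gamma\times\mathbb{R}^m$. (2) If $\rho$ is a spectral measure and the inclusion $\mathcal{Z}(\widehat{\mu})\cup\{0\}\subset\Gamma$ is an equality, i.e. $\mathcal{Z}(\widehat{\mu})\cup\{0\}=\Gamma$, then $\nu$ is a spectral measure and $\mu$ is a spectral measure with spectrum $\Gamma$.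
   Context: For $\lambda\in\mathbb{R}^d$ write $e_\lambda(x)=e^{2\pi i\langle\lambda,x\rangle}$. A finite positive Borel measure $\tau$ on $\mathbb{R}^d$ is a spectral measure if there is a countable set $\Lambda\subset\mathbb{R}^d$, called a spectrum of $\tau$, such that $\{e_\lambda:\lambda\in\Lambda\}$ is an orthogonal basis of $L^2(\tau)$. The Fourier transform is $\widehat{\tau}(\xi)=\int e^{-2\pi i\langle \xi,x\rangle}\,d\tau(x)$, $\xi\in\mathbb{R}^d$, and $\mathcal{Z}(\widehat{\tau})=\{\xi\in\mathbb{R}^d:\widehat{\tau}(\xi)=0\}$ is its zero set. No topological assumption (such as closedness or discreteness) is made on the subgroup $\Gamma$. *)

(* Defs.v *)
From HB Require Import structures.
From mathcomp Require Import all_boot all_order all_algebra.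
From mathcomp Require Import complex lra.
From mathcomp Require Import all_classical all_reals all_analysis.
Import Order.TTheory GRing.Theory Num.Theory.
Import numFieldNormedType.Exports.

Set Implicit Arguments.
Unset Strict Implicit.
Unset Printing Implicit Defensive.

Local Open Scope classical_set_scope.
Local Open Scope ring_scope.
Local Open Scope complex_scope.

(* R^n with the sigma-algebra generated by its open sets; the carrier is
   convertible to 'rV[R]_n. *)
Notation borelRn R n := (g_sigma_algebraType (@open 'rV[R]_n)).

Section ComplexL2.
Context d (T : measurableType d) (R : realType).
Variable tau : {measure set T -> \bar R}.

Definition cintegral (f : T -> R[i]) : R[i] :=
  (\int[tau]_x complex.Re (f x)) +i* (\int[tau]_x complex.Im (f x)).

Definition cmeasurable (f : T -> R[i]) : Prop :=
  measurable_fun setT (fun x => complex.Re (f x)) /\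
  measurable_fun setT (fun x => complex.Im (f x)).

Definition L2norm (f : T -> R[i]) : \bar R :=
  Lnorm tau (2 : R)%:E (fun x => (ComplexField.Normc.normc (f x))%:E).

Definition in_L2 (f : T -> R[i]) : Prop :=
  cmeasurable f /\ (L2norm f < +oo)%E.

Definition L2inner (f g : T -> R[i]) : R[i] :=
  cintegral (fun x => f x * (g x)^*).

(* The family (e l), indexed by l in L, is an orthogonal basis of L^2(tau):
   nonzero, pairwise orthogonal vectors whose linear span is dense. *)
Definition orthogonal_basis (V : eqType) (L : set V) (e : V -> T -> R[i]) :
    Prop :=
  [/\ forall l, L l -> in_L2 (e l) /\ L2norm (e l) != 0%E,
      forall l l', L l -> L l' -> l <> l' -> L2inner (e l) (e l') = 0
    & forall f, in_L2 f -> forall eps : R, 0 < eps ->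
        exists (s : seq V) (c : V -> R[i]),
          (forall l, l \in s -> L l) /\
          (L2norm (fun x => (f x - \sum_(l <- s) c l * e l x)%R) < eps%:E)%E].

End ComplexL2.

Section Spectral.
Context (R : realType) (n : nat).
Implicit Types (tau : {finite_measure set (borelRn R n) -> \bar R}).

Definition inner (u v : 'rV[R]_n) : R := \sum_(i < n) u 0 i * v 0 i.

Definition cis (t : R) : R[i] := cos t +i* sin t.

Definition character (l : 'rV[R]_n) (x : borelRn R n) : R[i] :=
  cis (2 * pi * inner l x).

Definition fourier tau (xi : 'rV[R]_n) : R[i] :=
  cintegral tau (fun x => cis (- (2 * pi * inner xi x))).

Definition zero_set tau : set 'rV[R]_n := [set xi | fourier tau xi = 0].

Definition is_spectrum tau (L : set 'rV[R]_n) : Prop :=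
  countable L /\ orthogonal_basis tau L character.

Definition spectral_measure tau : Prop := exists L, is_spectrum tau L.

End Spectral.

Section ProductMeasure.
Context (R : realType) (n m : nat).

Definition concat (p : borelRn R n * borelRn R m) : borelRn R (n + m) :=
  row_mx p.1 p.2.

(* The open sets of R^(n+m) are countable unions of rational boxes. *)
Lemma measurable_concat : measurable_fun setT concat.
Proof.
apply: (@measurability _ _ _ _ _ concat (@open 'rV[R]_(n + m))) => //.
move=> _ [U oU <-]; rewrite setTI.
pose ball1 k (a : 'rV[rat]_k) (j : nat) : set (borelRn R k) :=
  ball (map_mx ratr a : 'rV[R]_k) (j.+1%:R^-1).
have mball k a j : measurable (@ball1 k a j).
  apply: sub_sigma_algebra; exact: ball_open.
pose I := ('rV[rat]_n * 'rV[rat]_m * nat)%type.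
pose box (q : I) := ball1 _ q.1.1 q.2 `*` ball1 _ q.1.2 q.2.
pose F (q : I) := if `[< box q `<=` concat @^-1` U >] then box q else set0.
suff -> : concat @^-1` U = \bigcup_q F q.
  apply: countable_bigcupT_measurable; first exact: countableP.
  move=> q; rewrite /F; case: ifPn => _; last exact: measurable0.
  by apply: measurableX; exact: mball.
rewrite eqEsubset; split; last first.
  by move=> p [q _]; rewrite /F; case: asboolP => // + bq; apply.
move=> [x y] /= Uxy.
have /nbhs_ballP[e /= e0 eU] : nbhs (concat (x, y) : 'rV[R]_(n + m)) U.
  by move/open_nbhs_nbhs: (conj oU Uxy).
have [j j2e] : exists j : nat, j.+1%:R^-1 < e / 2.
  exists (Num.truncn (e / 2)^-1).
  rewrite invf_plt ?posrE ?divr_gt0//.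
  by rewrite truncnS_gt.
have approx k (v : 'rV[R]_k) : exists a : 'rV[rat]_k,
    ball (map_mx ratr a : 'rV[R]_k) (j.+1%:R^-1) v.
  have /choice[g gP] : forall i : 'I_k, exists q : rat,
      ball (ratr q : R) (j.+1%:R^-1) (v 0 i).
    move=> i; have : v 0 i - j.+1%:R^-1 < v 0 i + j.+1%:R^-1.
      by rewrite ltrBlDr -addrA ltrDl addr_gt0.
    move=> /rat_in_itvoo[q]; rewrite in_itv/= => /andP[h1 h2].
    exists q; rewrite /ball/= ltr_norml.
    move: (_^-1) h1 h2 => r h1 h2.
    by apply/andP; split; lra.
  exists (\row_i g i); split => // i' i.
  by rewrite ord1 !mxE.
have [a ax] := approx _ x; have [b bby] := approx _ y.
exists (a, b, j) => //; rewrite /F; case: asboolP => [_|[]].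
  by split.
move=> [x' y'] [/= [_ ax'] [_ by']].
apply: eU; split => // i' k; rewrite ord1.
case: ax => _ ax; case: bby => _ bby.
have j0 : j.+1%:R^-1 + j.+1%:R^-1 <= e by rewrite [leRHS]splitr lerD// ltW.
rewrite /concat/= !mxE; case: splitP => k' _.
  by apply: (le_ball j0); apply: ball_triangle (ax' _ _); exact: ball_sym.
by apply: (le_ball j0); apply: ball_triangle (by' _ _); exact: ball_sym.
Qed.

Variable mu : {finite_measure set (borelRn R n) -> \bar R}.
Variable nu : {finite_measure set (borelRn R m) -> \bar R}.

(* mu x nu, carried from R^n * R^m to R^(n+m). *)
Definition product_measure : set (borelRn R (n + m)) -> \bar R :=
  pushforward (mu \x nu)%E concat.

Let prod0 : product_measure set0 = 0%E.
Proof. by rewrite /product_measure /pushforward preimage_set0 measure0. Qed.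

Let prod_ge0 A : (0 <= product_measure A)%E.
Proof. by rewrite /product_measure /pushforward; apply: integral_ge0. Qed.

Let prod_sigma_additive : semi_sigma_additive product_measure.
Proof.
move=> F mF tF mUF; rewrite /product_measure /pushforward preimage_bigcup.
have mpre A : measurable A -> measurable (concat @^-1` A).
  by move=> mA; rewrite -[X in measurable X]setTI; exact: measurable_concat.
apply: (@measure_semi_sigma_additive _ _ _ (mu \x nu)%E) => [i||].
- exact: mpre.
- apply/trivIsetP => i j _ _ ij; rewrite -preimage_setI.
  by move/trivIsetP : tF => /(_ _ _ _ _ ij) ->//; rewrite preimage_set0.
- by rewrite -preimage_bigcup; exact: mpre.
Qed.

HB.instance Definition _ := isMeasure.Build _ _ _ product_measure
  prod0 prod_ge0 prod_sigma_additive.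

Let prod_fin : fin_num_fun product_measure.
Proof.
apply: lty_fin_num_fun => /=.
rewrite /product_measure /pushforward preimage_setT -setXTT.
rewrite product_measure1E//.
by rewrite lte_mul_pinfty ?ltey_eq ?fin_num_measure.
Qed.

HB.instance Definition _ := Measure_isFinite.Build _ _ _ product_measure
  prod_fin.

End ProductMeasure.

(* Main.v *)
(* Let rho = mu x nu have spectrum L.  If the first coordinates of l, k in L lie
   in different cosets of Gamma, then hat mu does not vanish at their
   difference, so orthogonality forces hat nu(k2 - l2) = 0: the coset classes of
   L are orthogonal along the second variable alone.  Hence the closed span of
   each class is stable under multiplication by characters of the first
   variable, and translating every class by a representative of its coset gives
   a spectrum inside Gamma x R^m.

   When Gamma is the zero set of hat mu with 0 added, distinct elements of Gamma
   are orthogonal in L^2(mu).  Projecting e_x (x) g on the terms of L above x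
   shows that the fibre of L above each x in Gamma is a spectrum of nu, so
   Gamma is a projection of L, hence countable; approximating f (x) 1 in
   L^2(rho) and freezing a good second variable approximates f by characters
   of Gamma. *)

Require Import Defs.
From mathcomp Require Import all_boot all_order all_algebra.
From mathcomp Require Import complex ring lra.
From mathcomp Require Import all_classical all_reals all_analysis.
From mathcomp Require Import measurable_realfun.
Import Order.TTheory GRing.Theory Num.Theory.
Import numFieldNormedType.Exports.

Set Implicit Arguments.
Unset Strict Implicit.
Unset Printing Implicit Defensive.

Local Open Scope classical_set_scope.
Local Open Scope ring_scope.

Local Notation Re := complex.Re.
Local Notation Im := complex.Im.

(** * Complex square-integrable functions *)

Section ComplexSquare.
Variable R : realType.
Implicit Types a b z : R[i].

(** The squared modulus, valued in [R] rather than in [R[i]], so that it can be integrated directly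
    and the estimates on it are polynomial. *)
Definition sqn z : R := Re z ^+ 2 + Im z ^+ 2.

Lemma ReM a b : Re (a * b) = Re a * Re b - Im a * Im b.
Proof. by case: a; case: b. Qed.

Lemma ImM a b : Im (a * b) = Re a * Im b + Im a * Re b.
Proof. by case: a; case: b. Qed.

Lemma ReD a b : Re (a + b) = Re a + Re b.
Proof. by case: a; case: b. Qed.

Lemma ImD a b : Im (a + b) = Im a + Im b.
Proof. by case: a; case: b. Qed.

Lemma ReN a : Re (- a) = - Re a.
Proof. by case: a. Qed.

Lemma ImN a : Im (- a) = - Im a.
Proof. by case: a. Qed.

Lemma ReJ a : Re (conjc a) = Re a.
Proof. by case: a. Qed.

Lemma ImJ a : Im (conjc a) = - Im a.
Proof. by case: a. Qed.

Definition ReImE := (ReM, ImM, ReD, ImD, ReN, ImN, ReJ, ImJ).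

Lemma complex_ext a b : Re a = Re b -> Im a = Im b -> a = b.
Proof. by case: a; case: b => /= ? ? ? ? -> ->. Qed.

Lemma sqn_ge0 z : 0 <= sqn z.
Proof. by rewrite addr_ge0// sqr_ge0. Qed.

Lemma sqnM a b : sqn (a * b) = sqn a * sqn b.
Proof. by rewrite /sqn !ReImE; ring. Qed.

(** The gap between the two sides is [sqn (a - b)]. This replaces the triangle inequality without
    taking square roots. *)
Lemma sqnD_le a b : sqn (a + b) <= 2 * (sqn a + sqn b).
Proof.
rewrite /sqn !ReImE.
have := sqr_ge0 (Re a - Re b); have := sqr_ge0 (Im a - Im b).
by move: (Re a) (Im a) (Re b) (Im b) => p q r s; nra.
Qed.

Lemma Re_mulJ_le a b : `|Re (a * conjc b)| <= sqn a + sqn b.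
Proof.
rewrite /sqn !ReImE ler_norml.
move: (Re a) (Im a) (Re b) (Im b) => p q r s.
have := sqr_ge0 (p - r); have := sqr_ge0 (q - s).
have := sqr_ge0 (p + r); have := sqr_ge0 (q + s).
by move=> *; apply/andP; split; nra.
Qed.

Lemma Im_mulJ_le a b : `|Im (a * conjc b)| <= sqn a + sqn b.
Proof.
rewrite /sqn !ReImE ler_norml.
move: (Re a) (Im a) (Re b) (Im b) => p q r s.
have := sqr_ge0 (p - s); have := sqr_ge0 (q - r).
have := sqr_ge0 (p + s); have := sqr_ge0 (q + r).
by move=> *; apply/andP; split; nra.
Qed.

(** Expanding [sqn (a - b)], the right side exceeds the left by exactly [sqn b]. Integrated, this is
    the inequality half of Pythagoras. *)
Lemma sqn_le_sub a b : sqn a <= sqn (a - b) + 2 * Re (a * conjc b).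
Proof.
rewrite /sqn !ReImE.
move: (Re a) (Im a) (Re b) (Im b) => p q r s.
by have := sqr_ge0 r; have := sqr_ge0 s; nra.
Qed.

End ComplexSquare.

(** * Collecting the terms of a finite sum by the value of a map *)

Section Regroup.
Variables (K : pzRingType) (I V : eqType).

(** A span element carries one coefficient per frequency. When frequencies are translated or
    projected, several of them may coincide, and their coefficients have to be added up. *)
Lemma regroup_sum (p : I -> V) (k : I -> K) (r : seq I) :
  exists (s : seq V) (c : V -> K), {subset s <= map p r} /\
    forall F : V -> K,
      \sum_(i <- r) k i * F (p i) = \sum_(v <- s) c v * F v.
Proof.
exists (undup (map p r)), (fun v => \sum_(i <- r | p i == v) k i).
split=> [v|F]; first by rewrite mem_undup.
under [RHS]eq_bigr do rewrite big_mkcond mulr_suml.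
rewrite exchange_big/=; apply: eq_big_seq => i ir.
rewrite (bigD1_seq (p i)) ?undup_uniq ?mem_undup ?map_f//= eqxx.
by rewrite big1 ?addr0// => v; rewrite eq_sym => /negbTE ->; rewrite mul0r.
Qed.

End Regroup.

(** * Squared norms and orthogonality over a finite measure *)

Section SquareIntegrable.
Context d (T : measurableType d) (R : realType).
Variable tau : {finite_measure set T -> \bar R}.
Implicit Types f g h : T -> R[i].

Definition sqnorm f : \bar R := (\int[tau]_x (sqn (f x))%:E)%E.

Definition L2 f := cmeasurable f /\ (sqnorm f < +oo)%E.

Lemma cmeasurableD f g : cmeasurable f -> cmeasurable g ->
  cmeasurable (fun x => f x + g x).
Proof.
move=> [rf if_] [rg ig]; split.
  by under eq_fun do rewrite ReD; exact: measurable_funD.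
by under eq_fun do rewrite ImD; exact: measurable_funD.
Qed.

Lemma cmeasurableM f g : cmeasurable f -> cmeasurable g ->
  cmeasurable (fun x => f x * g x).
Proof.
move=> [rf if_] [rg ig]; split.
  under eq_fun do rewrite ReM.
  by apply: measurable_funB; exact: measurable_funM.
under eq_fun do rewrite ImM.
by apply: measurable_funD; exact: measurable_funM.
Qed.

Lemma cmeasurableJ f : cmeasurable f -> cmeasurable (fun x => conjc (f x)).
Proof.
move=> [rf if_]; split; first by under eq_fun do rewrite ReJ.
under eq_fun do rewrite ImJ.
exact: measurableT_comp.
Qed.

Lemma cmeasurable_cst (a : R[i]) : cmeasurable (fun _ : T => a).
Proof. by split; exact: measurable_cst. Qed.

Lemma cmeasurableB f g : cmeasurable f -> cmeasurable g ->
  cmeasurable (fun x => f x - g x).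
Proof.
move=> mf mg; have := cmeasurableM (cmeasurable_cst (-1)) mg.
move/(cmeasurableD mf); rewrite (_ : (fun x => f x + -1 * g x) = fun x => f x - g x)//.
by apply/funext => x; rewrite mulN1r.
Qed.

Lemma cmeasurable_sum (V : eqType) (s : seq V) (c : V -> R[i])
    (e : V -> T -> R[i]) (P : pred V) :
  {in s, forall l, cmeasurable (e l)} ->
  cmeasurable (fun x => \sum_(l <- s | P l) c l * e l x).
Proof.
elim: s => [_|l s IH me].
  by under eq_fun do rewrite big_nil; exact: cmeasurable_cst.
under eq_fun do rewrite big_cons.
have ms : cmeasurable (fun x => \sum_(l <- s | P l) c l * e l x).
  by apply: IH => k ks; apply: me; rewrite inE ks orbT.
case: (P l) => //; apply: cmeasurableD => //.
by apply: cmeasurableM (cmeasurable_cst _) _; apply: me; rewrite inE eqxx.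
Qed.

Lemma measurable_sqn f : cmeasurable f ->
  measurable_fun setT (fun x => (sqn (f x))%:E).
Proof.
move=> [rf if_]; apply/measurable_EFinP; apply: measurable_funD;
  exact: measurable_funX.
Qed.

Lemma sqnorm_ge0 f : (0 <= sqnorm f)%E.
Proof. by apply: integral_ge0 => x _; rewrite lee_fin sqn_ge0. Qed.

Lemma L2normE f : L2norm tau f = (sqnorm f `^ 2^-1)%E.
Proof.
rewrite /L2norm unlock; congr (_ `^ _)%E; apply: eq_integral => x _.
rewrite abse_EFin poweR_EFin powR_mulrn// real_normK ?num_real//.
by case: (f x) => a b /=; rewrite sqr_sqrtr// addr_ge0// sqr_ge0.
Qed.

Lemma sqnormD f g : cmeasurable f -> cmeasurable g ->
  (sqnorm (fun x => f x + g x)%R <= 2%:E * (sqnorm f + sqnorm g))%E.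
Proof.
move=> mf mg; rewrite -ge0_integralD//; last 4 first.
- by move=> x _; rewrite lee_fin sqn_ge0.
- exact: measurable_sqn.
- by move=> x _; rewrite lee_fin sqn_ge0.
- exact: measurable_sqn.
rewrite -ge0_integralZl//; last 2 first.
- by apply: emeasurable_funD; exact: measurable_sqn.
- by move=> x _; rewrite -EFinD lee_fin addr_ge0// sqn_ge0.
apply: ge0_le_integral => //.
- by move=> x _; rewrite lee_fin sqn_ge0.
- by apply: measurable_sqn; exact: cmeasurableD.
- by apply: measurable_funeM; apply: emeasurable_funD; exact: measurable_sqn.
- by move=> x _; rewrite -EFinD -EFinM lee_fin sqnD_le.
Qed.

Lemma sqnormZ (a : R[i]) f : cmeasurable f ->
  sqnorm (fun x => a * f x) = ((sqn a)%:E * sqnorm f)%E.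
Proof.
move=> mf; rewrite -ge0_integralZl//.
- by apply: eq_integral => x _; rewrite sqnM.
- exact: measurable_sqn.
- by move=> x _; rewrite lee_fin sqn_ge0.
- by rewrite lee_fin sqn_ge0.
Qed.

(** Multiplication by a unimodular function is an isometry; it is applied with a character as
    [u]. *)
Lemma sqnormMu f (u : T -> R[i]) : (forall x, sqn (u x) = 1) ->
  sqnorm (fun x => u x * f x) = sqnorm f.
Proof. by move=> u1; apply: eq_integral => x _; rewrite sqnM u1 mul1r. Qed.

Lemma L2D f g : L2 f -> L2 g -> L2 (fun x => f x + g x).
Proof.
move=> [mf f2] [mg g2]; split; first exact: cmeasurableD.
apply: le_lt_trans (sqnormD mf mg) _.
by apply: lte_mul_pinfty => //; exact: lte_add_pinfty.
Qed.

Lemma L2Z (a : R[i]) f : L2 f -> L2 (fun x => a * f x).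
Proof.
move=> [mf f2]; split; first exact: cmeasurableM (cmeasurable_cst _) _.
by rewrite sqnormZ// lte_mul_pinfty ?lee_fin ?sqn_ge0.
Qed.

Lemma L2_sum (V : eqType) (s : seq V) (c : V -> R[i])
    (e : V -> T -> R[i]) (P : pred V) :
  {in s, forall l, L2 (e l)} -> L2 (fun x => \sum_(l <- s | P l) c l * e l x).
Proof.
elim: s => [_|l s IH me].
  under eq_fun do rewrite big_nil; split; first exact: cmeasurable_cst.
  by rewrite /sqnorm /sqn /= expr0n addr0 integral0.
under eq_fun do rewrite big_cons.
have ms : L2 (fun x => \sum_(l <- s | P l) c l * e l x).
  by apply: IH => k ks; apply: me; rewrite inE ks orbT.
case: (P l) => //; apply: L2D => //; apply: L2Z.
by apply: me; rewrite inE eqxx.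
Qed.

Lemma L2B f g : L2 f -> L2 g -> L2 (fun x => f x - g x).
Proof.
move=> mf mg; have := L2D mf (L2Z (-1) mg).
rewrite (_ : (fun x => f x + -1 * g x) = fun x => f x - g x)//.
by apply/funext => x; rewrite mulN1r.
Qed.

Lemma in_L2E f : in_L2 tau f <-> L2 f.
Proof.
rewrite /in_L2 /L2 L2normE; split=> -[mf fy]; split=> //.
  by apply: lty_poweRy fy; rewrite invr_neq0// pnatr_eq0.
exact: poweR_lty.
Qed.

Lemma L2norm_lt f (eps : R) : 0 < eps ->
  (L2norm tau f < eps%:E)%E = (sqnorm f < (eps ^+ 2)%:E)%E.
Proof.
move=> e0; rewrite L2normE.
have -> : eps%:E = ((eps ^+ 2)%:E `^ 2^-1)%E.
  by rewrite poweR_EFin -powR_mulrn ?ltW// -powRrM mulfV ?pnatr_eq0// powRr1 ?ltW.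
case: (sqnorm f) (sqnorm_ge0 f) => [r| |]//.
  rewrite lee_fin => r0; rewrite !poweR_EFin !lte_fin.
  apply/idP/idP; last by apply: gt0_ltr_powR; rewrite ?nnegrE ?sqr_ge0 ?invr_gt0.
  by apply: contraTT; rewrite -!leNgt; apply: ge0_ler_powR; rewrite ?nnegrE ?sqr_ge0 ?invr_ge0.
by rewrite poweRyr ?invr_neq0 ?pnatr_eq0.
Qed.

Definition cintegrable f :=
  tau.-integrable setT (EFin \o (fun x => Re (f x))) /\
  tau.-integrable setT (EFin \o (fun x => Im (f x))).

Lemma integrable_sqn f : L2 f -> tau.-integrable setT (EFin \o (fun x => sqn (f x))).
Proof.
move=> [mf f2]; apply/integrableP; split; first exact: measurable_sqn.
under eq_integral do rewrite /= ger0_norm ?sqn_ge0//.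
exact: f2.
Qed.

(** Real and imaginary parts are dominated by [sqn (f x) + sqn (g x)], so Cauchy-Schwarz is
    avoided. *)
Lemma cintegrable_mulJ f g : L2 f -> L2 g ->
  cintegrable (fun x => f x * conjc (g x)).
Proof.
move=> f2 g2.
have [mr mi] := cmeasurableM f2.1 (cmeasurableJ g2.1).
have ifg : tau.-integrable setT (EFin \o (fun x => sqn (f x) + sqn (g x))).
  exact: integrableD (integrable_sqn f2) (integrable_sqn g2).
split; apply: le_integrable ifg => //; try exact/measurable_EFinP.
- move=> x _; rewrite lee_fin [leRHS]ger0_norm; first exact: Re_mulJ_le.
  by apply: addr_ge0; exact: sqn_ge0.
- move=> x _; rewrite lee_fin [leRHS]ger0_norm; first exact: Im_mulJ_le.
  by apply: addr_ge0; exact: sqn_ge0.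
Qed.

Lemma integrableZ (k : R) (u : T -> R) : tau.-integrable setT (EFin \o u) ->
  tau.-integrable setT (EFin \o (fun x => k * u x)).
Proof. by move=> iu; exact: (integrableZl measurableT k iu). Qed.

Lemma cintegralD f g : cintegrable f -> cintegrable g ->
  cintegral tau (fun x => f x + g x) = cintegral tau f + cintegral tau g.
Proof.
move=> [rf if_] [rg ig]; apply: complex_ext; rewrite !ReImE/=.
  by under eq_Rintegral do rewrite ReD; rewrite RintegralD.
by under eq_Rintegral do rewrite ImD; rewrite RintegralD.
Qed.

Lemma cintegralZ (a : R[i]) f : cintegrable f ->
  cintegral tau (fun x => a * f x) = a * cintegral tau f.
Proof.
move=> [rf if_]; apply: complex_ext; rewrite !ReImE/=.
  under eq_Rintegral do rewrite ReM.
  rewrite RintegralB//; try exact: integrableZ.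
  by rewrite !RintegralZl.
under eq_Rintegral do rewrite ImM.
rewrite RintegralD//; try exact: integrableZ.
by rewrite !RintegralZl.
Qed.

Lemma cintegralJ f : cintegrable f ->
  cintegral tau (fun x => conjc (f x)) = conjc (cintegral tau f).
Proof.
move=> [rf if_]; apply: complex_ext; rewrite !ReImE/=.
  by under eq_Rintegral do rewrite ReJ.
under eq_Rintegral do rewrite ImJ -mulN1r.
by rewrite RintegralZl// mulN1r.
Qed.

Lemma L2inner0_sym f g : L2 f -> L2 g ->
  L2inner tau f g = 0 -> L2inner tau g f = 0.
Proof.
move=> f2 g2 fg0; rewrite /L2inner.
under eq_fun do rewrite -[g _]conjcK mulrC -rmorphM/=.
by rewrite cintegralJ ?[cintegral _ _]fg0 ?conjc0//; exact: cintegrable_mulJ.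
Qed.

Lemma L2inner0D f g h : L2 f -> L2 g -> L2 h ->
  L2inner tau f g = 0 -> L2inner tau f h = 0 ->
  L2inner tau f (fun x => g x + h x) = 0.
Proof.
move=> f2 g2 h2 fg fh; rewrite /L2inner.
have -> : (fun x => f x * conjc (g x + h x)) =
    fun x => f x * conjc (g x) + f x * conjc (h x).
  by apply/funext => x; rewrite rmorphD mulrDr.
rewrite cintegralD; [|exact: cintegrable_mulJ|exact: cintegrable_mulJ].
by rewrite [X in X + _]fg [X in _ + X]fh addr0.
Qed.

Lemma L2inner0Z (a : R[i]) f g : L2 f -> L2 g ->
  L2inner tau f g = 0 -> L2inner tau f (fun x => a * g x) = 0.
Proof.
move=> f2 g2 fg; rewrite /L2inner.
under eq_fun do rewrite rmorphM mulrCA.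
by rewrite cintegralZ ?[X in _ * X]fg ?mulr0//; exact: cintegrable_mulJ.
Qed.

Lemma L2inner0_sum (V : eqType) (s : seq V) (c : V -> R[i])
    (e : V -> T -> R[i]) (P : pred V) f : L2 f ->
  {in s, forall l, L2 (e l)} ->
  {in s, forall l, P l -> L2inner tau f (e l) = 0} ->
  L2inner tau f (fun x => \sum_(l <- s | P l) c l * e l x) = 0.
Proof.
move=> f2; elim: s => [_ _|l s IH e2 fe].
  rewrite /L2inner; have -> : (fun x => f x *
      conjc (\sum_(l <- [::] | P l) c l * e l x)) = fun _ => 0.
    by apply/funext => x; rewrite big_nil rmorph0 mulr0.
  by rewrite /cintegral /= !Rintegral_cst// !mul0r.
under eq_fun do rewrite big_cons.
have e2' : {in s, forall l, L2 (e l)}.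
  by move=> k ks; apply: e2; rewrite inE ks orbT.
have IH' : L2inner tau f (fun x => \sum_(l <- s | P l) c l * e l x) = 0.
  by apply: IH => // k ks Pk; apply: fe; rewrite ?inE ?ks ?orbT.
have el2 : L2 (e l) by apply: e2; rewrite inE eqxx.
case Pl : (P l) => //; apply: L2inner0D => //; [exact: L2Z|exact: L2_sum|].
by apply: L2inner0Z => //; apply: fe; rewrite ?inE ?eqxx.
Qed.

Lemma pythagoras_le f g : L2 f -> L2 g -> L2inner tau f g = 0 ->
  (sqnorm f <= sqnorm (fun x => f x - g x)%R)%E.
Proof.
move=> f2 g2 fg.
have [ir _] := cintegrable_mulJ f2 g2.
have fin h : L2 h -> sqnorm h = (\int[tau]_x sqn (h x))%:E.
  by move=> h2; rewrite /Rintegral fineK//; exact: integrable_fin_num (integrable_sqn h2).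
rewrite !fin//; last exact: L2B.
have re0 : \int[tau]_x Re (f x * conjc (g x)) = 0 by case: fg.
(* The added term integrates to twice the real part of the inner product, which is zero, and makes
   the pointwise bound [sqn_le_sub] applicable. *)
rewrite lee_fin; have -> : \int[tau]_x sqn (f x - g x) =
    \int[tau]_x (sqn (f x - g x) + 2 * Re (f x * conjc (g x))).
  rewrite RintegralD//; last 2 first.
  - exact: (integrable_sqn (L2B f2 g2)).
  - exact: integrableZ.
  by rewrite RintegralZl// re0 mulr0 addr0.
apply: le_Rintegral => //; first exact: integrable_sqn.
- exact: (integrableD measurableT (integrable_sqn (L2B f2 g2)) (integrableZ 2 ir)).
- by move=> x _; exact: sqn_le_sub.
Qed.

(* The discarded terms are orthogonal to [f] and to the terms that are kept. *)
Lemma sqnorm_drop_terms (V : eqType) (s : seq V) (c : V -> R[i])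
    (e : V -> T -> R[i]) (P : pred V) f : L2 f ->
  {in s, forall l, L2 (e l)} ->
  {in s &, forall l l', l <> l' -> L2inner tau (e l) (e l') = 0} ->
  {in s, forall l, ~~ P l -> L2inner tau f (e l) = 0} ->
  (sqnorm (fun x => f x - \sum_(l <- s | P l) c l * e l x)%R <=
   sqnorm (fun x => f x - \sum_(l <- s) c l * e l x)%R)%E.
Proof.
move=> f2 e2 eo fe.
pose g x := f x - \sum_(l <- s | P l) c l * e l x.
pose h x := \sum_(l <- s | ~~ P l) c l * e l x.
have -> : (fun x => f x - \sum_(l <- s) c l * e l x) = fun x => g x - h x.
  by apply/funext => x; rewrite (bigID P)/= opprD addrA.
have g2 : L2 g by apply: L2B => //; exact: L2_sum.
apply: pythagoras_le => //; first exact: L2_sum.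
apply: L2inner0_sum => // l ls nPl; apply: L2inner0_sym => //; first exact: e2.
rewrite /g; under eq_fun do rewrite -mulN1r.
have l2 := e2 _ ls; apply: L2inner0D => //.
- by apply: L2Z; exact: L2_sum.
- by apply: L2inner0_sym => //; exact: fe.
apply: L2inner0Z => //; first exact: L2_sum.
apply: L2inner0_sum => // k ks Pk; apply: eo => // lk.
by rewrite lk Pk in nPl.
Qed.

(** * Closed linear spans *)

Section Closure.
Variables (V : eqType) (L : set V) (e : V -> T -> R[i]).
Hypothesis e_meas : forall l, L l -> cmeasurable (e l).

(** The density clause of [orthogonal_basis] for a single [f], with the squared norm in place of the
    norm. *)
Definition closed_span f := forall eps : R, 0 < eps ->
  exists (s : seq V) (c : V -> R[i]), (forall l, l \in s -> L l) /\
    (sqnorm (fun x => f x - \sum_(l <- s) c l * e l x)%R < eps%:E)%E.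

Lemma closed_spanD f g : cmeasurable f -> cmeasurable g ->
  closed_span f -> closed_span g -> closed_span (fun x => f x + g x).
Proof.
(* [sqnormD] doubles the sum of the two errors, hence a quarter of [eps] for each. *)
move=> mf mg cf cg eps e0; have e40 : 0 < eps / 4 by rewrite divr_gt0.
have [s [c [sL sf]]] := cf _ e40; have [t [b [tL tg]]] := cg _ e40.
(* The two lists may share frequencies with different coefficients, so each frequency is tagged with
   its coefficient before regrouping. *)
pose r := [seq (l, c l) | l <- s] ++ [seq (l, b l) | l <- t].
have [u [a [ur uE]]] := regroup_sum fst snd r.
have rE x : \sum_(l <- u) a l * e l x =
    \sum_(l <- s) c l * e l x + \sum_(l <- t) b l * e l x.
  by rewrite -(uE (fun l => e l x)) big_cat !big_map.
exists u, a; split.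
  move=> l /ur /mapP[p]; rewrite mem_cat => /orP[|] /mapP[k kl ->] -> /=.
    exact: sL.
  exact: tL.
rewrite (_ : (fun x => _) = fun x => (f x - \sum_(l <- s) c l * e l x) +
    (g x - \sum_(l <- t) b l * e l x)); last first.
  by apply/funext => x; rewrite rE opprD addrACA.
apply: le_lt_trans (sqnormD _ _) _.
- by apply: cmeasurableB => //; apply: cmeasurable_sum => l /sL; exact: e_meas.
- by apply: cmeasurableB => //; apply: cmeasurable_sum => l /tL; exact: e_meas.
have -> : eps%:E = (2%:E * ((eps / 4)%:E + (eps / 4)%:E))%E.
  by rewrite -EFinD -EFinM; congr EFin; field.
by rewrite lte_pmul2l//; exact: lteD.
Qed.

Lemma closed_spanZ (a : R[i]) f : cmeasurable f ->
  closed_span f -> closed_span (fun x => a * f x).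
Proof.
move=> mf cf eps e0.
(* Adding 1 keeps the divisor positive when [a] is zero. *)
have b0 : 0 < sqn a + 1 by rewrite ltr_wpDl// sqn_ge0.
have [|s [c [sL sf]]] := cf (eps / (sqn a + 1)); first by rewrite divr_gt0.
exists s, (fun l => a * c l); split=> //.
rewrite (_ : (fun x => _) = fun x => a * (f x - \sum_(l <- s) c l * e l x)); last first.
  apply/funext => x; rewrite mulrBr mulr_sumr; congr (_ - _).
  by apply: eq_bigr => l _; rewrite mulrA.
rewrite sqnormZ; last first.
  by apply: cmeasurableB => //; apply: cmeasurable_sum => l /sL; exact: e_meas.
apply: (@le_lt_trans _ _ ((sqn a + 1)%:E * sqnorm (fun x => f x - \sum_(l <- s) c l * e l x)%R)%E).
  by apply: lee_wpmul2r; rewrite ?sqnorm_ge0// lee_fin lerDl.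
have -> : eps%:E = ((sqn a + 1)%:E * (eps / (sqn a + 1))%:E)%E.
  by rewrite -EFinM; congr EFin; field; exact: lt0r_neq0.
by rewrite lte_pmul2l.
Qed.

Lemma closed_span_sum (W : eqType) (s : seq W) (c : W -> R[i])
    (h : W -> T -> R[i]) :
  {in s, forall l, cmeasurable (h l) /\ closed_span (h l)} ->
  closed_span (fun x => \sum_(l <- s) c l * h l x).
Proof.
elim: s => [_|l s IH hs].
  move=> eps e0; exists [::], (fun=> 0); split=> //.
  under eq_fun do rewrite !big_nil subr0.
  by rewrite /sqnorm /sqn /= expr0n addr0 integral0.
under eq_fun do rewrite big_cons.
have hs' : {in s, forall l, cmeasurable (h l) /\ closed_span (h l)}.
  by move=> k ks; apply: hs; rewrite inE ks orbT.
have [|ml cl] := hs l; first by rewrite inE eqxx.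
apply: closed_spanD.
- exact: cmeasurableM (cmeasurable_cst _) _.
- by apply: cmeasurable_sum => k /hs' [].
- exact: closed_spanZ.
- exact: IH.
Qed.

Lemma closed_span_closed f : cmeasurable f ->
  (forall eps : R, 0 < eps -> exists g, [/\ cmeasurable g, closed_span g
     & (sqnorm (fun x => f x - g x)%R < eps%:E)%E]) ->
  closed_span f.
Proof.
move=> mf cf eps e0; have e40 : 0 < eps / 4 by rewrite divr_gt0.
have [g [mg cg fg]] := cf _ e40; have [s [c [sL sg]]] := cg _ e40.
exists s, c; split=> //.
rewrite (_ : (fun x => _) = fun x => (f x - g x) +
    (g x - \sum_(l <- s) c l * e l x)); last first.
  by apply/funext => x; rewrite addrA subrK.
apply: le_lt_trans (sqnormD _ _) _.
- exact: cmeasurableB.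
- by apply: cmeasurableB => //; apply: cmeasurable_sum => l /sL; exact: e_meas.
have -> : eps%:E = (2%:E * ((eps / 4)%:E + (eps / 4)%:E))%E.
  by rewrite -EFinD -EFinM; congr EFin; field.
by rewrite lte_pmul2l//; exact: lteD.
Qed.

End Closure.

Lemma orthogonal_basisE (V : eqType) (L : set V) (e : V -> T -> R[i]) :
  (forall l, L2 (e l)) -> (forall l, sqnorm (e l) != 0%E) ->
  orthogonal_basis tau L e <->
  (forall l l', L l -> L l' -> l <> l' -> L2inner tau (e l) (e l') = 0) /\
  (forall f, L2 f -> closed_span L e f).
Proof.
move=> e2 e0; split=> [[_ eo ed]|[eo ed]].
  split=> // f /in_L2E /ed fd eps eps0.
  (* [orthogonal_basis] bounds the norm and [closed_span] its square, so tolerances are exchanged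
     through a square root here and a square in the converse. *)
  have se : 0 < Num.sqrt eps by rewrite sqrtr_gt0.
  have [s [c [sL]]] := fd _ se; rewrite L2norm_lt// sqr_sqrtr ?ltW// => ?.
  by exists s, c.
split=> //.
- move=> l _; split; first exact/in_L2E.
  rewrite L2normE; apply: contra (e0 l) => /eqP/poweR_eq0_eq0 -> //.
  exact: sqnorm_ge0.
- move=> f /in_L2E /ed fd eps eps0.
  have [|s [c [sL ?]]] := fd (eps ^+ 2); first by rewrite exprn_gt0.
  by exists s, c; rewrite L2norm_lt.
Qed.

End SquareIntegrable.

(** * Characters and product measures on R^n *)

Section Characters.
Variables (R : realType) (n : nat).
Implicit Types (l k : 'rV[R]_n) (tau : {finite_measure set (borelRn R n) -> \bar R}).

Lemma measurable_coord (i : 'I_n) :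
  measurable_fun setT (fun x : borelRn R n => (x : 'rV[R]_n) 0 i : R).
Proof.
pose f (x : borelRn R n) : R := (x : 'rV[R]_n) 0 i.
apply: (@measurability _ _ _ _ setT f (@RGenOInfty.G R)).
  exact: RGenOInfty.measurableE.
move=> _ [_ [a ->] <-]; rewrite setTI; apply: sub_sigma_algebra.
have /continuousP := @coord_continuous R 1 n 0 i.
by apply; exact: interval_open.
Qed.

Lemma measurable_inner l : measurable_fun setT (fun x : borelRn R n => inner l x).
Proof.
apply: measurable_sum => i; apply: measurable_funM => //.
exact: measurable_coord.
Qed.

Lemma cmeasurable_character l : cmeasurable (@character R n l).
Proof.
have ml : measurable_fun setT (fun x : borelRn R n => 2 * pi * inner l x).
  by apply: measurable_funM => //; exact: measurable_inner.
split=> /=.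
  by apply: measurableT_comp ml; apply: continuous_measurable_fun; exact: continuous_cos.
by apply: measurableT_comp ml; apply: continuous_measurable_fun; exact: continuous_sin.
Qed.

Lemma sqn_character l x : sqn (@character R n l x) = 1.
Proof. exact: cos2Dsin2. Qed.

Lemma innerD l k x : inner (l + k) x = inner l x + inner k x.
Proof. by rewrite -big_split; apply: eq_bigr => i _; rewrite mxE mulrDl. Qed.

Lemma innerN l x : inner (- l) x = - inner l x.
Proof. by rewrite -sumrN; apply: eq_bigr => i _; rewrite mxE mulNr. Qed.

Lemma characterD l k x : character (l + k) x = character l x * character k x.
Proof.
rewrite /character innerD mulrDr; apply: complex_ext; rewrite !ReImE/=.
  by rewrite cosD.
by rewrite sinD addrC; congr (_ + _); rewrite mulrC.
Qed.

Lemma characterN l x : character (- l) x = conjc (character l x).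
Proof. by rewrite /character /cis innerN mulrN cosN sinN. Qed.

Lemma character0 x : @character R n 0 x = 1.
Proof.
have x0 : inner (0 : 'rV[R]_n) x = 0.
  by rewrite /inner big1// => i _; rewrite mxE mul0r.
by rewrite /character /cis x0 mulr0 cos0 sin0.
Qed.

Lemma fourierE tau l : fourier tau l = cintegral tau (character (- l)).
Proof.
by congr cintegral; apply/funext => x; rewrite /character innerN mulrN.
Qed.

Lemma L2inner_character tau l k :
  L2inner tau (character l) (character k) = fourier tau (k - l).
Proof.
rewrite fourierE; congr cintegral; apply/funext => x.
by rewrite opprB characterD characterN.
Qed.

Lemma fourier0_neq0 tau : tau setT <> 0%E -> fourier tau 0 <> 0.
Proof.
rewrite fourierE oppr0 => t0.
have -> : @character R n 0 = fun=> 1 by apply/funext => x; exact: character0.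
case; rewrite Rintegral_cst// mul1r => ft _; apply: t0.
by rewrite -[LHS]fineK ?ft//; exact: fin_num_measure.
Qed.

Lemma sqnorm_character tau l : sqnorm tau (character l) = tau setT.
Proof.
rewrite -[RHS]mul1e -integral_cst//; apply: eq_integral => x _.
by rewrite sqn_character.
Qed.

Lemma L2_character tau l : L2 tau (character l).
Proof.
split; first exact: cmeasurable_character.
by rewrite sqnorm_character ltey_eq fin_num_measure.
Qed.

(** The working form of the definition. Characters have squared norm [tau setT], so nonzero mass
    makes them nonzero vectors, and their inner products are values of the Fourier transform. *)
Lemma is_spectrumE tau (L : set 'rV[R]_n) : tau setT <> 0%E ->
  is_spectrum tau L <-> [/\ countable L,
    forall l k, L l -> L k -> l <> k -> fourier tau (k - l) = 0
    & forall f, L2 tau f -> closed_span tau L (@character R n) f].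
Proof.
move=> t0; have s0 l : sqnorm tau (character l) != 0%E.
  by rewrite sqnorm_character; exact/eqP.
have eqv := @orthogonal_basisE _ _ _ tau _ L (@character R n) (L2_character tau) s0.
split=> [[cL /eqv[Lo Ld]]|[cL Lo Ld]].
  split=> // l k Ll Lk lk; rewrite -L2inner_character; exact: Lo.
split=> //; apply/eqv; split=> // l k Ll Lk lk.
by rewrite L2inner_character; exact: Lo.
Qed.

End Characters.

(** * Tensor products of functions and Fubini for the product measure *)

Section Tensor.
Variables (R : realType) (n m : nat).
Variable mu : {finite_measure set (borelRn R n) -> \bar R}.
Variable nu : {finite_measure set (borelRn R m) -> \bar R}.
Let rho : {finite_measure set (borelRn R (n + m)) -> \bar R} :=
  product_measure mu nu.

Let pr1 (z : borelRn R (n + m)) : borelRn R n := lsubmx (z : 'rV[R]_(n + m)).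
Let pr2 (z : borelRn R (n + m)) : borelRn R m := rsubmx (z : 'rV[R]_(n + m)).

Definition tensor (f : borelRn R n -> R[i]) (g : borelRn R m -> R[i]) :
  borelRn R (n + m) -> R[i] := fun z => f (pr1 z) * g (pr2 z).

Lemma measurable_lsubmx : measurable_fun setT pr1.
Proof.
apply: (@measurability _ _ _ _ setT pr1 (@open 'rV[R]_n)) => // _ [U oU <-]; rewrite setTI.
apply: sub_sigma_algebra.
by move/continuousP : (@continuous_lsubmx R 1 n m); exact.
Qed.

Lemma measurable_rsubmx : measurable_fun setT pr2.
Proof.
apply: (@measurability _ _ _ _ setT pr2 (@open 'rV[R]_m)) => // _ [U oU <-]; rewrite setTI.
apply: sub_sigma_algebra.
by move/continuousP : (@continuous_rsubmx R 1 n m); exact.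
Qed.

Lemma pr1_concat p : pr1 (concat p) = p.1.
Proof. by rewrite /pr1 /concat row_mxKl. Qed.

Lemma pr2_concat p : pr2 (concat p) = p.2.
Proof. by rewrite /pr2 /concat row_mxKr. Qed.

Lemma cmeasurable_tensor f g : cmeasurable f -> cmeasurable g ->
  cmeasurable (tensor f g).
Proof.
move=> [rf if_] [rg ig]; apply: cmeasurableM.
  by split; [exact: measurableT_comp rf measurable_lsubmx
            |exact: measurableT_comp if_ measurable_lsubmx].
by split; [exact: measurableT_comp rg measurable_rsubmx
          |exact: measurableT_comp ig measurable_rsubmx].
Qed.

Lemma character_tensor (l : 'rV[R]_(n + m)) :
  character l = tensor (character (lsubmx l)) (character (rsubmx l)).
Proof.
apply/funext => z; rewrite /tensor.
have -> : character l z = cis (2 * pi * (inner (lsubmx l) (pr1 z) + inner (rsubmx l) (pr2 z))).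
  congr (cis (_ * _)); rewrite /inner big_split_ord/=.
  by congr (_ + _); apply: eq_bigr => i _; rewrite !mxE.
rewrite /character mulrDr; apply: complex_ext; rewrite !ReImE/=.
  by rewrite cosD.
by rewrite sinD addrC; congr (_ + _); rewrite mulrC.
Qed.

Lemma product_measureT : rho setT = (mu setT * nu setT)%E.
Proof.
by rewrite /rho/= /product_measure /pushforward preimage_setT -setXTT product_measure1E.
Qed.

Lemma ge0_integral_product (F : borelRn R (n + m) -> \bar R) :
  measurable_fun setT F -> (forall z, 0 <= F z)%E ->
  (\int[rho]_z F z = \int[(mu \x nu)%E]_p F (concat p))%E.
Proof.
move=> mF F0.
have <- := ge0_integral_pushforward (@measurable_concat R n m) (mu \x nu)%E
  measurableT mF (fun z _ => F0 z).
(* [rho] and the pushforward are different measure structures with the same values. *)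
by apply: eq_measure_integral => //; exact: measurable_concat.
Qed.

Lemma sqnorm_productE h : cmeasurable h ->
  sqnorm rho h = (\int[nu]_y sqnorm mu (fun x => h (concat (x, y))))%E.
Proof.
move=> mh; rewrite /sqnorm ge0_integral_product.
- rewrite fubini_tonelli2//.
  + exact: measurableT_comp (measurable_sqn mh) (@measurable_concat R n m).
  + by move=> p; rewrite lee_fin sqn_ge0.
- exact: measurable_sqn.
- by move=> z; rewrite lee_fin sqn_ge0.
Qed.

(** Averaging: if every slice had squared norm at least [eps], integrating over [nu] would give at
    least [eps * nu setT]. *)
Lemma exists_slice h (eps : R) : 0 <= eps -> cmeasurable h ->
  (sqnorm rho h < eps%:E * nu setT)%E ->
  exists y, (sqnorm mu (fun x => h (concat (x, y))) < eps%:E)%E.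
Proof.
move=> e0 mh; rewrite sqnorm_productE// => hlt; apply: contrapT => noy.
have hle y : (eps%:E <= sqnorm mu (fun x => h (concat (x, y))))%E.
  by rewrite leNgt; apply/negP => ylt; apply: noy; exists y.
move: hlt; rewrite ltNge -integral_cst// => /negP; apply.
apply: ge0_le_integral => //; last by move=> y _; exact: hle.
apply: (measurable_fun_fubini_tonelli_G (fun p => (sqn (h (concat p)))%:E)) => //.
  exact: measurableT_comp (measurable_sqn mh) (@measurable_concat R n m).
by move=> p; rewrite lee_fin sqn_ge0.
Qed.

Lemma sqnorm_tensor f g : cmeasurable f -> cmeasurable g ->
  sqnorm rho (tensor f g) = (sqnorm mu f * sqnorm nu g)%E.
Proof.
move=> mf mg; rewrite sqnorm_productE; last exact: cmeasurable_tensor.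
rewrite -ge0_integralZl//; last 3 first.
- exact: measurable_sqn.
- by move=> y _; rewrite lee_fin sqn_ge0.
- exact: sqnorm_ge0.
apply: eq_integral => y _; rewrite muleC -sqnormZ//.
by congr sqnorm; apply/funext => x; rewrite /tensor pr1_concat pr2_concat mulrC.
Qed.

Lemma L2_tensor f g : L2 mu f -> L2 nu g -> L2 rho (tensor f g).
Proof.
move=> [mf f2] [mg g2]; split; first exact: cmeasurable_tensor.
rewrite sqnorm_tensor// lte_mul_pinfty ?sqnorm_ge0//.
by rewrite ge0_fin_numE ?sqnorm_ge0.
Qed.

(** Tonelli applied to absolute values gives integrability on the product, and Fubini then separates
    the integral. The complex case splits into four such real products. *)
Lemma Rintegral_product (u : borelRn R n -> R) (v : borelRn R m -> R) :
  mu.-integrable setT (EFin \o u) -> nu.-integrable setT (EFin \o v) ->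
  rho.-integrable setT (EFin \o (fun z => u (pr1 z) * v (pr2 z))) /\
  \int[rho]_z (u (pr1 z) * v (pr2 z)) = (\int[mu]_x u x) * (\int[nu]_y v y).
Proof.
move=> iu iv.
have mu_ : measurable_fun setT u by apply/measurable_EFinP; exact: measurable_int iu.
have mv_ : measurable_fun setT v by apply/measurable_EFinP; exact: measurable_int iv.
pose F := fun z => (u (pr1 z) * v (pr2 z))%:E.
have mF : measurable_fun setT F.
  apply/measurable_EFinP; apply: measurable_funM.
    exact: measurableT_comp measurable_lsubmx.
  exact: measurableT_comp measurable_rsubmx.
have FcE : F \o @concat R n m = fun p => (u p.1 * v p.2)%:E.
  by apply/funext => p; rewrite /F /= pr1_concat pr2_concat.
have mFc : measurable_fun setT (F \o @concat R n m).
  by apply: measurableT_comp (@measurable_concat R n m).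
have iFc : (mu \x nu)%E.-integrable setT (F \o @concat R n m).
  apply/integrable12ltyP => //; rewrite FcE.
  under eq_integral => x _.
    under eq_integral do rewrite /= normrM EFinM.
    rewrite ge0_integralZl//; last first.
      by apply/measurable_EFinP; exact: measurableT_comp.
    over.
  rewrite ge0_integralZr//; last 2 first.
  - by apply/measurable_EFinP; exact: measurableT_comp.
  - by apply: integral_ge0.
  have [_ ?] := integrableP _ _ _ iu; have [_ ?] := integrableP _ _ _ iv.
  apply: lte_mul_pinfty => //; first exact: integral_ge0.
  by rewrite ge0_fin_numE//; exact: integral_ge0.
have ip := integrable_pushforward (@measurable_concat R n m) mF iFc measurableT.
have intE G : (\int[rho]_z G z = \int[pushforward (mu \x nu)%E (@concat R n m)]_z G z)%E.
  by apply: eq_measure_integral => //; exact: measurable_concat.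
split.
  by apply/integrableP; split=> //; rewrite intE; have [_ +] := integrableP _ _ _ ip.
rewrite /Rintegral intE.
rewrite (integral_pushforward (@measurable_concat R n m) mF iFc measurableT).
rewrite -integral12_prod_meas1// FcE.
have finu : (\int[mu]_x (u x)%:E)%E \is a fin_num by exact: integrable_fin_num iu.
have finv : (\int[nu]_x (v x)%:E)%E \is a fin_num by exact: integrable_fin_num iv.
rewrite -fineM//; congr fine.
rewrite -[in RHS](fineK finv) muleC -integralZl//; apply: eq_integral => x _.
rewrite fineK// muleC -integralZl//; apply: eq_integral => y _.
Qed.

Lemma cintegral_tensor f g : cintegrable mu f -> cintegrable nu g ->
  cintegral rho (tensor f g) = cintegral mu f * cintegral nu g.
Proof.
move=> [rf if_] [rg ig].
have [rr rrE] := Rintegral_product rf rg.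
have [ri riE] := Rintegral_product rf ig.
have [ir irE] := Rintegral_product if_ rg.
have [ii iiE] := Rintegral_product if_ ig.
apply: complex_ext; rewrite !ReImE/=.
  under eq_Rintegral do rewrite ReM.
  by rewrite RintegralB// rrE iiE.
under eq_Rintegral do rewrite ImM.
by rewrite RintegralD// riE irE.
Qed.

Lemma L2inner_tensor f g f' g' : L2 mu f -> L2 nu g -> L2 mu f' -> L2 nu g' ->
  L2inner rho (tensor f g) (tensor f' g') = L2inner mu f f' * L2inner nu g g'.
Proof.
move=> f2 g2 f2' g2'; rewrite -cintegral_tensor; [|exact: cintegrable_mulJ..].
by congr cintegral; apply/funext => z; rewrite /tensor rmorphM mulrACA.
Qed.

(** The transform at [l] is the inner product of the characters at 0 and [l], and both are
    tensors. *)
Lemma fourier_product (l : 'rV[R]_(n + m)) :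
  fourier rho l = fourier mu (lsubmx l) * fourier nu (rsubmx l).
Proof.
rewrite -[in LHS](subr0 l) -L2inner_character !character_tensor L2inner_tensor;
  try exact: L2_character.
by rewrite !L2inner_character !linear0 !addr0.
Qed.

End Tensor.

(** * Spectra of a product measure *)

Section Cosets.
Variables (V : zmodType) (G : set V).
Hypotheses (G0 : G 0) (GB : forall x y, G x -> G y -> G (x - y)).

(** The choice is made from the coset as a set, so equal cosets receive the same representative. The
    default 0 never arises, because [x] lies in its own coset. *)
Definition coset_rep (x : V) : V := xget 0 [set y | G (x - y)].

Lemma coset_repP x : G (x - coset_rep x).
Proof. by apply: (@xgetPex _ 0 [set y | G (x - y)]); exists x; rewrite /= subrr. Qed.

Lemma coset_repE x y : coset_rep x = coset_rep y <-> G (x - y).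
Proof.
split=> [xy|Gxy].
  rewrite (_ : x - y = (x - coset_rep x) - (y - coset_rep y)).
    by apply: GB; exact: coset_repP.
  by rewrite xy opprB addrA subrK.
have Gyx : G (y - x) by rewrite -opprB -sub0r; exact: GB.
congr xget; apply/seteqP; split=> z /= Gz.
  by rewrite (_ : y - z = (x - z) - (x - y)); [exact: GB|rewrite opprB [RHS]addrC addrA subrK].
by rewrite (_ : x - z = (y - z) - (y - x)); [exact: GB|rewrite opprB [RHS]addrC addrA subrK].
Qed.

End Cosets.

Section Spectra.
Variables (R : realType) (n m : nat).
Variable mu : {finite_measure set (borelRn R n) -> \bar R}.
Variable nu : {finite_measure set (borelRn R m) -> \bar R}.
Hypotheses (mu_neq0 : mu setT <> 0%E) (nu_neq0 : nu setT <> 0%E).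
Variable G : set 'rV[R]_n.
Hypotheses (G0 : G 0) (GB : forall x y, G x -> G y -> G (x - y)).
Local Notation rho := (product_measure mu nu).
Local Notation e := (@character R _).

Lemma product_measureT_neq0 : (rho : set (borelRn R (n + m)) -> \bar R) setT <> 0%E.
Proof.
move=> r0; have /eqP : (mu setT * nu setT)%E = 0%E by rewrite -product_measureT.
by rewrite mule_eq0 => /orP[/eqP|/eqP].
Qed.

(** * First claim: translating a spectrum into the subgroup *)

Section Shift.
Hypothesis ZG : zero_set mu `<=` G.
Variable L : set 'rV[R]_(n + m).
Hypothesis L_spec : is_spectrum rho L.

(** The zero second block makes the translation leave second coordinates unchanged. *)
Let rep (l : 'rV[R]_(n + m)) : 'rV[R]_(n + m) :=
  row_mx (coset_rep G (lsubmx l)) 0.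

Definition shift_to_subgroup (l : 'rV[R]_(n + m)) := l - rep l.
Local Notation shift := shift_to_subgroup.

Let repE l k : rep l = rep k <-> G (lsubmx l - lsubmx k).
Proof.
rewrite -(coset_repE G0 GB); split=> [|lk]; last by rewrite /rep lk.
by move/eq_row_mx => [].
Qed.

Let rsub_rep l : rsubmx (rep l) = 0.
Proof. by rewrite row_mxKr. Qed.

(** The transform of [rho] at [k - l] is zero and factors. The factor from [mu] cannot vanish, since
    its zeros lie in [G] and would put [l] and [k] in one coset. *)
Lemma fourier_distinct_cosets l k : L l -> L k -> rep l <> rep k ->
  fourier nu (rsubmx (k - l)) = 0.
Proof.
move=> Ll Lk lk.
have [_ Lo _] := (is_spectrumE L product_measureT_neq0).1 L_spec.
have /eqP : fourier rho (k - l) = 0 by apply: Lo => // lkE; apply: lk; rewrite lkE.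
rewrite fourier_product mulf_eq0 => /orP[/eqP /ZG|/eqP//].
by rewrite linearB/= => /repE kl; case: lk.
Qed.

(* Cosets are orthogonal on every fibre, so twisting by a character of the
   first variable preserves the closed span of each coset. *)
Lemma character_closed_span_shift l : L l -> closed_span rho (shift @` L) e (e l).
Proof.
move=> Ll eps e0.
have [_ Lo Ld] := (is_spectrumE L product_measureT_neq0).1 L_spec.
(* The approximated function is the character at [l + rep l]: multiplying by the character at
   [- rep l] turns it into [e l], and turns each term of the coset of [l] into a character of the
   shifted set. *)
have [s [c [sL slt]]] := Ld _ (L2_character rho (l + rep l)) _ e0.
pose P k := rep k == rep l.
have [s' [c' [s'L s'E]]] := regroup_sum shift c [seq k <- s | P k].
exists s', c'; split.
  by move=> k /s'L /mapP[j]; rewrite mem_filter => /andP[_ /sL Lj] ->; exists j.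
apply: le_lt_trans slt.
have -> : (fun x => e l x - \sum_(k <- s') c' k * e k x) =
    (fun x => e (- rep l) x * (e (l + rep l) x - \sum_(k <- s | P k) c k * e k x)).
  apply/funext => x; rewrite -(s'E (fun k => e k x)) big_filter mulrBr.
  rewrite -characterD (_ : - rep l + (l + rep l) = l); last by rewrite addrC addrK.
  rewrite mulr_sumr; congr (_ - _).
  apply: eq_bigr => k /eqP kl; rewrite /shift kl characterD.
  by rewrite mulrA [RHS]mulrC.
rewrite sqnormMu; last exact: sqn_character.
apply: sqnorm_drop_terms => //.
- exact: L2_character.
- by move=> k _; exact: L2_character.
- by move=> j k /sL Lj /sL Lk jk; rewrite L2inner_character; exact: Lo.
(* Adding [rep l] does not affect the second coordinate, so the factor from [nu] still vanishes for
   terms of other cosets. *)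
- move=> k /sL Lk /eqP kl; rewrite L2inner_character fourier_product.
  rewrite opprD addrA [in X in _ * X]linearB/= rsub_rep subr0.
  by rewrite fourier_distinct_cosets ?mulr0// => lk; apply: kl.
Qed.

(** Within a coset, differences do not change; across cosets, the factor from [nu] vanishes. For
    density, the old characters span a dense space and each lies in the new closed span. *)
Lemma is_spectrum_shift : is_spectrum rho (shift @` L).
Proof.
have [cL Lo Ld] := (is_spectrumE L product_measureT_neq0).1 L_spec.
apply/is_spectrumE; first exact: product_measureT_neq0.
split.
- exact: sub_countable (card_image_le _ _) cL.
- move=> _ _ [l Ll <-] [k Lk <-] lk.
  have [lkE|lkE] := pselect (rep l = rep k).
    rewrite /shift -lkE opprB addrA subrK; apply: Lo => // lkE'.
    by apply: lk; rewrite lkE'.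
  rewrite fourier_product.
  have -> : rsubmx (shift k - shift l) = rsubmx (k - l).
    rewrite /shift_to_subgroup !linearB/= !rsub_rep.
    by rewrite !oppr0 !addr0.
  by rewrite fourier_distinct_cosets ?mulr0.
- move=> f f2; apply: closed_span_closed.
  + by move=> l _; exact: cmeasurable_character.
  + exact: f2.1.
  move=> eps e0; have [s [c [sL slt]]] := Ld _ f2 _ e0.
  exists (fun x => \sum_(l <- s) c l * e l x); split=> //.
    by apply: cmeasurable_sum => l _; exact: cmeasurable_character.
  apply: closed_span_sum; first by move=> l _; exact: cmeasurable_character.
  move=> l /sL Ll; split; first exact: cmeasurable_character.
  exact: character_closed_span_shift.
Qed.

Lemma shift_subset : shift @` L `<=` [set l | G (lsubmx l)].
Proof.
move=> _ [l Ll <-] /=; rewrite linearB/= row_mxKl; exact: coset_repP.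
Qed.

End Shift.

(** * Second claim: spectra of the two factors *)

Section Factors.
Hypothesis ZG : zero_set mu `|` [set 0] = G.
Variable L : set 'rV[R]_(n + m).
Hypothesis L_spec : is_spectrum rho L.
Hypothesis LG : L `<=` [set l | G (lsubmx l)].

Let fourier_subgroup x : G x -> x <> 0 -> fourier mu x = 0.
Proof. by rewrite -ZG => -[]. Qed.

Lemma fibre_approximation x g (eps : R) : G x -> L2 nu g -> 0 < eps ->
  exists (s : seq 'rV[R]_(n + m)) (c : 'rV[R]_(n + m) -> R[i]),
    (forall l, l \in s -> L l /\ lsubmx l = x) /\
    (mu setT * sqnorm nu (fun y => g y - \sum_(l <- s) c l * e (rsubmx l) y)%R
      < eps%:E)%E.
Proof.
move=> Gx g2 e0.
have [_ Lo Ld] := (is_spectrumE L product_measureT_neq0).1 L_spec.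
have xg2 := L2_tensor (L2_character mu x) g2.
have [s [c [sL slt]]] := Ld _ xg2 _ e0.
pose P (l : 'rV[R]_(n + m)) := lsubmx l == x.
exists [seq l <- s | P l], c; split.
  by move=> l; rewrite mem_filter => /andP[/eqP lx /sL].
apply: le_lt_trans slt.
rewrite -(sqnorm_character mu x) -sqnorm_tensor; last 2 first.
- exact: cmeasurable_character.
- apply: cmeasurableB g2.1 _.
  by apply: cmeasurable_sum => l _; exact: cmeasurable_character.
have -> : tensor (e x) (fun y => g y - \sum_(l <- [seq l <- s | P l]) c l * e (rsubmx l) y) =
    fun z => tensor (e x) g z - \sum_(l <- s | P l) c l * e l z.
  apply/funext => z; rewrite /tensor big_filter mulrBr mulr_sumr; congr (_ - _).
  by apply: eq_bigr => l /eqP <-; rewrite character_tensor mulrCA.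
apply: sqnorm_drop_terms => //.
- by move=> l _; exact: L2_character.
- by move=> j k /sL Lj /sL Lk jk; rewrite L2inner_character; exact: Lo.
- move=> l /sL Ll /eqP lx; rewrite character_tensor L2inner_tensor//;
    try exact: L2_character.
  rewrite L2inner_character fourier_subgroup ?mul0r//.
    by apply: GB => //; exact: LG.
  by move/subr0_eq.
Qed.

(** Two points above 0 differ by 0 in the first variable, where the transform of [mu] is its nonzero
    mass, so their orthogonality must come from [nu]. *)
Lemma spectral_measure_fibre :
  is_spectrum nu (rsubmx @` [set l | L l /\ lsubmx l = 0]).
Proof.
have [cL Lo Ld] := (is_spectrumE L product_measureT_neq0).1 L_spec.
apply/is_spectrumE => //; split.
- apply: sub_countable (card_image_le _ _) _; apply: sub_countable cL.
  by apply: subset_card_le => l [].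
- move=> _ _ [l [Ll l0] <-] [k [Lk k0] <-] lk.
  have /eqP : fourier rho (k - l) = 0 by apply: Lo => // lkE; apply: lk; rewrite lkE.
  rewrite fourier_product !linearB/= l0 k0 subrr mulf_eq0 => /orP[/eqP|/eqP//].
  by move/fourier0_neq0; case.
- move=> g g2 eps e0.
  have fmu : mu setT \is a fin_num by exact: fin_num_measure.
  have M0 : (0 < mu setT)%E by rewrite lt0e measure_ge0 andbT; exact/eqP.
  have fM0 : 0 < fine (mu setT) by rewrite fine_gt0// M0 ltey_eq fmu.
  have [|s [c [sL slt]]] := fibre_approximation (eps := fine (mu setT) * eps) G0 g2.
    exact: mulr_gt0.
  have [s' [c' [s'L s'E]]] := regroup_sum rsubmx c s.
  exists s', c'; split; first by move=> y /s'L /mapP[l /sL ? ->]; exists l.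
  move: slt; rewrite EFinM fineK// lte_pmul2l//.
  by under eq_fun do rewrite (s'E (fun l => e l _)).
Qed.

(** With nothing of [L] above [x], the approximating sum is empty and the error is the full mass of
    [rho]; taking that mass as tolerance gives a contradiction. *)
Lemma subgroup_sub_projection : G `<=` lsubmx @` L.
Proof.
move=> x Gx.
have fr : rho setT \is a fin_num by exact: fin_num_measure.
have r0 : 0 < fine (rho setT).
  rewrite fine_gt0// ltey_eq fr andbT lt0e measure_ge0 andbT.
  by apply/eqP; exact: product_measureT_neq0.
have [[|l s] [c [sL]]] := fibre_approximation Gx (L2_character nu 0) r0; last first.
  by move=> _; have [|Ll <-] := sL l; [rewrite inE eqxx|exists l].
under eq_fun do rewrite big_nil subr0.
by rewrite fineK// sqnorm_character -product_measureT ltxx.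
Qed.

Lemma is_spectrum_subgroup : is_spectrum mu G.
Proof.
have [cL _ Ld] := (is_spectrumE L product_measureT_neq0).1 L_spec.
apply/is_spectrumE => //; split.
- apply: sub_countable (subset_card_le subgroup_sub_projection) _.
  exact: sub_countable (card_image_le _ _) cL.
- move=> l k Gl Gk lk; apply: fourier_subgroup; first exact: GB.
  by move/subr0_eq => kl; apply: lk.
- move=> f f2 eps e0.
  have fnu : nu setT \is a fin_num by exact: fin_num_measure.
  have fN0 : 0 < fine (nu setT).
    rewrite fine_gt0// ltey_eq fnu andbT lt0e measure_ge0 andbT; exact/eqP.
  (* The character at 0 is the constant 1. The tolerance is scaled by the mass of [nu] so that
     [exists_slice] returns an error below [eps]. *)
  have [|s [c [sL]]] := Ld _ (L2_tensor f2 (L2_character nu 0)) (eps * fine (nu setT)).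
    exact: mulr_gt0.
  rewrite EFinM fineK// => /exists_slice[||y ylt]; first exact: ltW.
    apply: cmeasurableB (L2_tensor f2 (L2_character nu 0)).1 _.
    by apply: cmeasurable_sum => l _; exact: cmeasurable_character.
  (* With [y] frozen, characters of the second variable are constants absorbed into the
     coefficients; points of [L] above the same first coordinate are merged. *)
  have [s' [c' [s'L s'E]]] := regroup_sum lsubmx (fun l => c l * e (rsubmx l) y) s.
  exists s', c'; split; first by move=> x /s'L /mapP[l /sL /LG ? ->].
  apply: le_lt_trans ylt; rewrite le_eqVlt; apply/orP; left; apply/eqP.
  congr sqnorm; apply/funext => x; rewrite -(s'E (fun l => e l x)).
  rewrite /tensor pr1_concat pr2_concat character0 mulr1; congr (_ - _).
  apply: eq_bigr => l _; rewrite character_tensor /tensor pr1_concat pr2_concat.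
  by rewrite -mulrA; congr (_ * _); exact: mulrC.
Qed.

End Factors.

End Spectra.

Theorem theorem1p2 (R : realType) (n m : nat)
    (mu : {finite_measure set (borelRn R n) -> \bar R})
    (nu : {finite_measure set (borelRn R m) -> \bar R})
    (mu_neq0 : mu setT <> 0%E) (nu_neq0 : nu setT <> 0%E)
    (Gamma : set 'rV[R]_n)
    (Gamma_subgroup : zmod_closed (mem Gamma))
    (Z_Gamma : zero_set mu `|` [set 0] `<=` Gamma) :
  (spectral_measure (product_measure mu nu) ->
     exists L : set 'rV[R]_(n + m),
       is_spectrum (product_measure mu nu) L /\
       L `<=` [set l | Gamma (lsubmx l)])
  /\
  (spectral_measure (product_measure mu nu) ->
   zero_set mu `|` [set 0] = Gamma ->
     spectral_measure nu /\ is_spectrum mu Gamma).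
Proof.
have [G0' GB'] := Gamma_subgroup.
have G0 : Gamma 0 by apply/set_mem.
have GB x y : Gamma x -> Gamma y -> Gamma (x - y).
  by move=> Gx Gy; apply/set_mem; apply: GB'; exact: mem_set.
have ZG : zero_set mu `<=` Gamma by move=> x Zx; apply: Z_Gamma; left.
(* Isolated because the second claim also starts by replacing the given spectrum with one inside the
   subgroup. *)
have part1 : spectral_measure (product_measure mu nu) ->
    exists L : set 'rV[R]_(n + m), is_spectrum (product_measure mu nu) L /\
      L `<=` [set l | Gamma (lsubmx l)].
  move=> [L L_spec]; exists (shift_to_subgroup Gamma @` L); split.
    exact: is_spectrum_shift.
  exact: shift_subset.
split=> // /part1[L [L_spec LG]] ZE; split.
  by eexists; exact: spectral_measure_fibre L_spec LG.
exact: is_spectrum_subgroup L_spec LG.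
Qed.
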